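(* For any uncountable regular cardinal $\kappa$ there is a densely ordered chain $(X,<)$ without endpoints, of cardinality $\kappa$, which is epimorphism-rigid but which embeds into each of its non-empty open intervals (that is, for every non-empty open interval $I$ of $X$ there is a strictly order-preserving map from $X$ into $I$).
   Context: The axiom of choice is assumed (ZFC). A chain is a linearly ordered set. An epimorphism of a chain $X$ is a surjective map $f:X\to X$ with $x\le y\Rightarrow f(x)\le f(y)$. A chain is epimorphism-rigid if its only epimorphism is the identity map. *)

(* Defs.v *)
From mathcomp Require Export all_boot all_order interval.
From mathcomp Require Export boolp classical_sets cardinality set_interval.
From mathcomp Require wochoice.

Set Implicit Arguments.
Unset Strict Implicit.
Unset Printing Implicit Defensive.

Local Open Scope classical_set_scope.
Local Open Scope card_scope.

(* A cardinal is an ordinal which is not equinumerous with any smaller ordinal.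
   An ordinal is given, up to isomorphism, by a reflexive well-ordering [R] of a
   type [K]; the smaller ordinals are then the proper initial segments of [R]. *)
Definition initial_ordinal (K : Type) (R : rel K) : Prop :=
  wochoice.well_order R /\
  forall a : K, ~~ ([set: K] #= [set x | R x a /\ x <> a]).

Definition cofinal (K : Type) (R : rel K) (A : set K) : Prop :=
  forall x : K, exists2 a, A a & R x a.

(* The cardinality of [K] is a regular cardinal: an infinite initial ordinal
   which equals its own cofinality, i.e. the least cardinality of a cofinal
   subset. All initial well-orderings of [K] are isomorphic, so it does not
   matter which one is used. *)
Definition regular_cardinal (K : Type) : Prop :=
  infinite_set [set: K] /\
  exists2 R : rel K, initial_ordinal R
    & forall A : set K, cofinal R A -> A #= [set: K].

Definition densely_ordered d (X : orderType d) : Prop :=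
  forall x y : X, (x < y)%O -> exists z : X, (x < z < y)%O.

Definition without_endpoints d (X : orderType d) : Prop :=
  forall x : X, (exists y : X, (y < x)%O) /\ (exists y : X, (x < y)%O).

Definition epimorphism d (X : orderType d) (f : X -> X) : Prop :=
  (forall y : X, exists x : X, f x = y) /\ {homo f : x y / (x <= y)%O}.

Definition epimorphism_rigid d (X : orderType d) : Prop :=
  forall f : X -> X, epimorphism f -> f =1 id.

(* The open intervals are those of the library, so both the bounded ones and
   the open rays (and [X] itself) are included. *)
Definition embeds_in_open_intervals d (X : orderType d) : Prop :=
  forall i : interval X, itv_open_ends i -> (exists x : X, x \in i) ->
  exists f : X -> X, {homo f : x y / (x < y)%O} /\ forall x : X, f x \in i.

(* Main.v *)
(* Elements of [X] are finite words over [K], ordered lexicographically with an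
   end-marker [Top] above all letters. The letters [x] following a prefix [s] cut the set
   of words below [s Top] into [K]-many blocks; at a limit letter [x] we add a least
   element [s x Bot] to the block of [s x] unless [x] belongs to a stationary set [S s],
   where the sets [S s] are pairwise disjoint (Solovay). Since [K] is regular and
   uncountable, the only lower sets of cofinality [K] are those of the form
   {z | z < s Top}. If [f] is an epimorphism, the preimage of such a lower set is again
   one, {z | z < t Top} say. As [f] preserves existing suprema, [S s] is contained in
   [S t] modulo a club, so [s = t]. These lower sets separate points, so [f] is the
   identity. On the other hand every open interval contains all extensions of some prefix,
   and [X] embeds in these because embeddings need not preserve suprema. *)
From HB Require Import structures.
Require Import Defs.
From mathcomp Require Import functions.
Import Order.TTheory.

Set Implicit Arguments.
Unset Strict Implicit.
Unset Printing Implicit Defensive.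

Local Open Scope classical_set_scope.
Local Open Scope card_scope.
Local Open Scope order_scope.

Lemma card_leT_inj (T U : Type) (B : set U) : [set: T] #<= B ->
  exists f : T -> U, (forall x, B (f x)) /\ injective f.
Proof.
move=> /card_leP[e]; have inT x : x \in [set: T] by rewrite in_setT.
exists (fun x => sval (e (SigSub (inT x)))); split=> [x|x y /val_inj exy].
  by have /set_mem := valP (e (SigSub (inT x))).
by have := inj (f := e) _ _ exy; rewrite !inE => /(_ I I) [].
Qed.

(** * Stationary sets in an uncountable regular well-order *)

Section Stationary.
Variables (d : Order.disp_t) (K : orderType d).
Implicit Types (A : set K) (g : K -> K) (a b c x y : K).

(** For regular [K] this says that [I] has smaller cardinality than [K]. *)
Definition small (I : Type) := forall g : I -> K, exists b, forall i, g i < b.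

Definition limit_point c :=
  (exists a, a < c) /\ forall a, a < c -> exists2 b, a < b & b < c.

(* [{c | forall a, a < c -> g a < c}] is a club, and by regularity every club contains
   one of this form. *)
Definition stationary A := forall g,
  exists c, [/\ A c, limit_point c & forall a, a < c -> g a < c].

Lemma sub_stationary A B : A `<=` B -> stationary A -> stationary B.
Proof. by move=> AB stA g; have [c [/AB]] := stA g; exists c. Qed.

Hypothesis K_wf : forall A, A !=set0 -> exists2 x, A x & forall y, A y -> x <= y.
Hypothesis K_reg : forall A b, (forall x, A x -> x < b) -> small {x | A x}.
Hypothesis K_nat : small nat.
Hypothesis K_card : forall A, (forall b, exists2 x, A x & b <= x) -> A #= [set: K].

Lemma exists_gt a : exists b, a < b.
Proof. by have [b ltb] := K_nat (fun=> a); exists b; apply: (ltb 0%N). Qed.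

Lemma stationary_gt A b : stationary A -> exists2 x, A x & b < x.
Proof. by move=> /(_ (fun=> b))[c [Ac [[a ac] _]]] /(_ a ac); exists c. Qed.

Lemma stationary_card A : stationary A -> A #= [set: K].
Proof.
move=> stA; apply: K_card => b.
by have [x Ax /ltW] := stationary_gt b stA; exists x.
Qed.

(** Initial segments are small, so [h] can be bounded in one variable after the other. A point
    closed under [g] is then closed under [h a] for every smaller [a]: this is a diagonal
    intersection of clubs. *)
Lemma bound2 (h : K -> K -> K) :
  exists g, forall a b c, a <= c -> b <= c -> h a b < g c.
Proof.
suff /choice[g gP] : forall c, exists e, forall a b, a <= c -> b <= c -> h a b < e.
  by exists g => a b c; apply: gP.
move=> c; have [c' cc'] := exists_gt c.
have sm : small {x | x <= c}.
  by apply: (@K_reg _ c') => x /le_lt_trans; apply.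
have /choice[f fP] : forall a, exists e, forall i : {x | x <= c}, h a (sval i) < e.
  by move=> a; apply: (sm (fun i => h a (sval i))).
have [e eP] := sm (fun i => f (sval i)).
exists e => a b ac bc.
exact: lt_trans (fP a (exist _ b bc)) (eP (exist _ a ac)).
Qed.

Lemma not_stationary A : ~ stationary A ->
  exists g, forall c, A c -> limit_point c -> ~ forall a, a < c -> g a < c.
Proof.
move=> /existsNP[g /forallNP gP].
by exists g => c Ac lc gc; apply: (gP c).
Qed.

(** If no fiber is stationary, each misses a club; a point of [A] in the diagonal intersection of
    these clubs lies in the club missed by its own fiber. *)
Lemma fodor A f : stationary A -> (forall a, A a -> f a < a) ->
  exists c, stationary (A `&` [set a | f a = c]).
Proof.
move=> stA f_lt; apply: contrapT => /forallNP nst.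
have /choice[G GP] := fun c => not_stationary (nst c).
have [g gP] := bound2 G.
have [c [Ac lc gc]] := stA g.
apply: (GP (f c) c) => // a ac.
have m_lt : Order.max (f c) a < c by rewrite gt_max f_lt.
by apply: lt_trans (gc _ m_lt); apply: gP; rewrite le_max lexx ?orbT.
Qed.

Definition omega_limit c := exists s : nat -> K,
  (forall n, s n < c) /\ forall b, b < c -> exists n, b < s n.

Variable x0 : K.

Lemma stationary_omega_limit : stationary omega_limit.
Proof.
(* The maximum with [b] makes [g'] exceed the identity as well as [g], so its iterates increase and
   their supremum is closed under [g]. *)
move=> g; have [g' g'P] := bound2 (fun a b => Order.max (g a) b).
have g'_gt a b : a <= b -> (g a < g' b) /\ (b < g' b).
  by move=> ab; have := g'P a b b ab (lexx b); rewrite gt_max => /andP.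
pose s n := iter n g' x0.
have sS n : s n < s n.+1 by have [] := g'_gt _ _ (lexx (s n)).
have [c sc c_min] := K_wf (K_nat s : [set b | forall n, s n < b] !=set0).
have s_cof b : b < c -> exists n, b < s n.
  move=> bc; apply: contrapT => /forallNP nb.
  suff /c_min : forall n, s n < b by rewrite leNgt bc.
  by move=> n; have /negP := nb n.+1; rewrite -leNgt; apply: lt_le_trans.
exists c; split; first by exists s.
  split; first by exists (s 0%N); apply: sc.
  by move=> a /s_cof[n an]; exists (s n).
move=> a /s_cof[n an].
by apply: lt_trans (sc n.+1); have [] := g'_gt _ _ (ltW an).
Qed.

(* Solovay's splitting argument: choose cofinal sequences [s c : nat -> K]; for some [n]
   the regressive function [c |-> s c n] is unbounded on every club. *)
Lemma stationary_fibers : exists f : K -> K,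
  forall b, exists2 c, stationary [set a | f a = c] & b <= c.
Proof.
have /choice[s sP] : forall c, exists s : nat -> K, omega_limit c ->
    (forall n, s n < c) /\ forall b, b < c -> exists n, b < s n.
  move=> c; have [[s sP]|nl] := pselect (omega_limit c); first by exists s.
  by exists (fun=> c).
have [n nP] : exists n, forall b, stationary [set c | omega_limit c /\ b <= s c n].
  apply: contrapT => /forallNP nst.
  have /choice[b bP] : forall n, exists b,
      ~ stationary [set c | omega_limit c /\ b <= s c n].
    by move=> n; apply/existsNP/nst.
  have /choice[G GP] := fun n => not_stationary (bP n).
  have [b1 b1P] := K_nat b.
  (* Closure under [g] puts [c] in all the clubs given by [G] and above [b1], hence above every
     [b n]. *)
  have /choice[g gP] : forall a, exists e, forall n, Order.max b1 (G n a) < e.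
    by move=> a; apply: K_nat.
  have [c [oc lc gc]] := stationary_omega_limit g.
  have [s_lt s_cof] := sP c oc.
  have b1c : b1 < c.
    have [[a ac] _] := lc.
    by have := gP a 0%N; rewrite gt_max => /andP[+ _] => /lt_trans; apply; apply: gc.
  have [n nP] := s_cof _ b1c.
  apply: (GP n c _ lc) => [|a ac].
    by split=> //; apply/ltW/(lt_trans (b1P n)).
  by have := gP a n; rewrite gt_max => /andP[_ /lt_trans]; apply; apply: gc.
exists (fun c => s c n) => b.
have [|c stc] := fodor (f := fun c => s c n) (nP b).
  by move=> a [oa _]; have [] := sP a oa.
exists c; first by apply: sub_stationary stc => a [].
by have [a [[]]] := stationary_gt b stc; move=> _ + <-.
Qed.

(** By [K_card] there are enough stationary fibers to index them by [K]. The least element is no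
    limit point, so it can be taken out of all of them; it will code the empty sequence. *)
Lemma disjoint_stationary : exists F : K -> set K,
  [/\ forall x, stationary (F x), forall x y a, F x a -> F y a -> x = y
    & exists c, forall x, ~ F x c].
Proof.
have [f fP] := stationary_fibers.
pose G := [set c | stationary [set a | f a = c]].
have /card_eqPle[_ /card_leT_inj[e [eG e_inj]]] : G #= [set: K] := K_card fP.
have [o _ o_min] := K_wf (ex_intro _ x0 I : [set: K] !=set0).
exists (fun x => [set a | f a = e x /\ a <> o]); split.
- move=> x g; have : stationary [set a | f a = e x] by apply: eG.
  move=> /(_ g)[c [/= fc lc gc]]; exists c; split=> //; split=> // co.
  by have [[a]] := lc; rewrite co ltNge o_min.
- by move=> x y a [/= -> _] [/= exy _]; apply: e_inj.
- by exists o => x [].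
Qed.

(* [pair x] injects [K] into the [x]-th of [K]-many disjoint sets of full size,
   so that no separate proof of [K * K #= K] is needed. *)
Lemma seq_code : exists code : seq K -> K, injective code.
Proof.
have [F [F_st F_disj [o F_o]]] := disjoint_stationary.
have /choice[pair pairP] : forall x, exists p : K -> K,
    (forall y, F x (p y)) /\ injective p.
  by move=> x; have /card_eqPle[_ /card_leT_inj] := stationary_card (F_st x).
exists (foldr pair o); elim=> [|x s IHs] [|y t] //=.
- by move=> E; have [/(_ (foldr pair o t))] := pairP y; rewrite -E => /F_o.
- by move=> E; have [/(_ (foldr pair o s))] := pairP x; rewrite E => /F_o.
move=> E; have xy : x = y.
  apply: (F_disj _ _ (pair x (foldr pair o s))).
    by have [] := pairP x.
  by rewrite E; have [] := pairP y.
by subst y; have [_ inj_p] := pairP x; congr (_ :: _); apply/IHs/inj_p.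
Qed.

Lemma disjoint_stationary_seq : exists S : seq K -> set K,
  (forall s, stationary (S s)) /\ forall s t a, S s a -> S t a -> s = t.
Proof.
have [F [F_st F_disj _]] := disjoint_stationary.
have [code codeI] := seq_code.
exists (F \o code); split=> [s|s t a Ss]; first exact: F_st.
by move=> /(F_disj _ _ _ Ss)/codeI.
Qed.

End Stationary.

(** * Words with end-markers and their lexicographic order *)

Inductive word (K : Type) := Bot | Top | Cons of K & word K.
Arguments Bot {K}.
Arguments Top {K}.

Section WordOrder.
Variables (d : Order.disp_t) (K : orderType d).

Fixpoint wlt (u v : word K) : bool :=
  match u, v with
  | _, Bot => false
  | Bot, _ => true
  | Top, _ => false
  | Cons _ _, Top => true
  | Cons x u', Cons y v' => (x < y) || (x == y) && wlt u' v'
  end.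

Lemma wlt_irr : irreflexive wlt.
Proof. by elim=> //= x u ->; rewrite ltxx eqxx. Qed.

Lemma wlt_trans : transitive wlt.
Proof.
move=> v u w; elim: u v w => [|| x u IHu] [|| y v] [|| z w] //=.
move=> /orP[xy|/andP[/eqP-> uv]] /orP[yz|/andP[/eqP<- vw]].
- by rewrite (lt_trans xy yz).
- by rewrite xy.
- by rewrite yz.
- by rewrite eqxx (IHu _ _ uv vw) orbT.
Qed.

HB.instance Definition _ := gen_eqMixin (word K).
HB.instance Definition _ := gen_choiceMixin (word K).

Lemma wlt_total (u v : word K) : u != v -> wlt u v || wlt v u.
Proof.
elim: u v => [|| x u IHu] [|| y v] //=; rewrite ?eqxx //.
case: (ltgtP x y) => //= <- uv; apply: IHu.
by apply: contra_neq uv => ->.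
Qed.

HB.instance Definition _ := Order.LtOrder.Build d (word K)
  (fun _ _ => erefl) (fun _ _ => erefl) (fun _ _ => erefl)
  wlt_irr wlt_trans wlt_total.

Implicit Types (x y : K) (u v w : word K) (r s t : seq K).

Definition wcat s u : word K := foldr (@Cons K) u s.

Lemma lt_Bot u : (u < Bot) = false. Proof. by case: u. Qed.
Lemma Bot_lt u : (Bot < u) = (u != Bot).
Proof. by case: u => [|| x u] /=; rewrite ?ltxx ?eqxx //; apply/esym/eqP. Qed.
Lemma lt_Cons x y u v : (Cons x u < Cons y v) = (x < y) || (x == y) && (u < v).
Proof. by []. Qed.

Lemma lt_wcat s u v : (wcat s u < wcat s v) = (u < v).
Proof. by elim: s => //= x s IHs; rewrite lt_Cons ltxx eqxx. Qed.

Lemma wcat_rcons s x u : wcat (rcons s x) u = wcat s (Cons x u).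
Proof. by elim: s => //= y s ->. Qed.

End WordOrder.

(** * Admissible words and the blocks between them *)

Section Words.
Variables (d : Order.disp_t) (K : orderType d).
Implicit Types (x y : K) (u v w : word K) (r s t : seq K) (S : seq K -> set K).

(** Each recursive call shifts [S] by the letter just read, so [S [::]] is always the set attached
    to the prefix before the current letter. *)
Fixpoint admissible S w : Prop :=
  match w with
  | Bot => False
  | Top => True
  | Cons x Bot => limit_point x /\ ~ S [::] x
  | Cons x u => admissible (fun s => S (x :: s)) u
  end.

Fixpoint Bot_free w : bool :=
  match w with Bot => false | Top => true | Cons _ u => Bot_free u end.

Lemma Bot_free_wcat s u : Bot_free (wcat s u) = Bot_free u.
Proof. by elim: s. Qed.

Lemma Bot_free_admissible S w : Bot_free w -> admissible S w.
Proof. by elim: w S => [|| x [|| y u] IHu] S //= bu; apply: (IHu (fun s => S (x :: s))). Qed.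

Lemma admissible_limit S s x :
  admissible S (wcat s (Cons x Bot)) <-> limit_point x /\ ~ S s x.
Proof. by elim: s S => [|y [|z s] IHs] S //=; apply: (IHs (fun r => S (y :: r))). Qed.

Lemma admissible_neq_Bot S w : admissible S w -> w <> Bot.
Proof. by move=> + wB; rewrite wB. Qed.

Hypothesis exists_gtK : forall x, exists y, x < y.
Variables x0 : K.

(** The first difference decides, so one larger letter works for all continuations [w]: whole blocks
    approach [wcat r Top] from below. *)
Lemma lt_wcat_Top r u : u < wcat r Top -> exists x, forall w, u < wcat r (Cons x w).
Proof.
elim: r u => [|y r IHr] [|| x u] //=.
- by exists x0.
- by have [y xy] := exists_gtK x; exists y => w; rewrite lt_Cons xy.
- by exists x0.
rewrite lt_Cons => /orP[xy|/andP[/eqP-> /IHr[z zP]]].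
  by exists x0 => w; rewrite lt_Cons xy.
by exists z => w; rewrite lt_Cons eqxx zP orbT.
Qed.

Lemma lt_wcat_limit r x u : limit_point x -> u < wcat r (Cons x Bot) ->
  exists2 y, y < x & forall w, u < wcat r (Cons y w).
Proof.
move=> [[a ax] lx]; elim: r u => [|y r IHr] [|| z u] //=.
- by exists a.
- rewrite lt_Cons lt_Bot andbF orbF => /lx[b zb bx].
  by exists b => // w; rewrite lt_Cons zb.
- by exists a.
rewrite lt_Cons => /orP[zy|/andP[/eqP-> /IHr[b bx bP]]].
  by exists a => // w; rewrite lt_Cons zy.
by exists b => // w; rewrite lt_Cons eqxx bP orbT.
Qed.

(** Both admissible endings, [Top] and a limit letter followed by [Bot], are suprema of whole
    blocks. Leaving [u] arbitrary lets [Bot] serve as a lower end. *)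
Lemma admissible_between S u v : admissible S v -> u < v ->
  exists r x, forall w, u < wcat r (Cons x w) < v.
Proof.
elim: v S u => [|| y v IHv] S u //.
  move=> _ /(@lt_wcat_Top [::])[x xP]; exists [::], x => w.
  by rewrite xP.
case: v IHv => [_ /= [ly _] | IHv okv | z v IHv okv].
- move=> /(@lt_wcat_limit [::] _ _ ly)[x xy xP]; exists [::], x => w.
  by rewrite xP lt_Cons xy.
- move=> /(@lt_wcat_Top [:: y])[x xP]; exists [:: y], x => w.
  by rewrite xP lt_Cons eqxx orbT.
have IH := IHv (fun s => S (y :: s)) ^~ okv.
(* A block below [v] that still starts with [y] serves every [u] that is [Bot] or starts with a
   smaller letter. *)
have low : exists r x, forall w, Cons y Bot < wcat r (Cons x w) < Cons y (Cons z v).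
  have [//|r [x rx]] := IH Bot; exists (y :: r), x => w.
  by rewrite !lt_Cons ltxx eqxx; apply: rx.
case: u => [_|//|a u].
  by have [r [x rx]] := low; exists r, x => w; have /andP[/(lt_trans _)->] := rx w.
rewrite lt_Cons => /orP[ay|/andP[/eqP-> /IH[r [x rx]]]].
  have [r [x rx]] := low; exists r, x => w.
  by have /andP[/(lt_trans _)->//] := rx w; rewrite lt_Cons ay.
by exists (y :: r), x => w; rewrite !lt_Cons ltxx eqxx; apply: rx.
Qed.

Variable x1 : K.
Hypothesis lt01 : x0 < x1.

(* Pushes [Bot] up to a word ending in [Top], while keeping it below the images of
   all other words. *)
Fixpoint spread w : word K :=
  match w with
  | Bot => Cons x0 Top
  | Top => Top
  | Cons x u => Cons x1 (Cons x (spread u))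
  end.

Lemma Bot_free_spread w : Bot_free (spread w).
Proof. by elim: w. Qed.

Lemma spread_lt u v : u < v -> spread u < spread v.
Proof.
elim: u v => [|| x u IHu] [|| y v] //=; rewrite !lt_Cons ?lt01 //.
by case/orP=> [->|/andP[/eqP-> /IHu->]]; rewrite !ltxx !eqxx ?orbT.
Qed.

End Words.

(** * Sets of words of cofinality [K] *)

Section Cuts.
Variables (d : Order.disp_t) (K : orderType d).
Implicit Types (x y : K) (u v w : word K) (r s t : seq K) (D : set (word K)).

Hypothesis K_reg : forall (A : set K) b, (forall x, A x -> x < b) -> small K {x | A x}.
Hypothesis K_nat : small K nat.
Variable x0 : K.

(** For a set in a linear order this means cofinality at least that of [K]; strict bounds exclude a
    maximum, and the empty family makes [D] non-empty. *)
Definition directed D := forall I : Type, small K I ->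
  forall g : I -> word K, (forall i, D (g i)) -> exists2 e, D e & forall i, g i < e.

Lemma directed_nonempty D : directed D -> D !=set0.
Proof.
move=> dD; have sm : small K False by move=> g; exists x0; case.
by have [|e De _] := dD False sm (fun=> Bot); [case|exists e].
Qed.

Lemma directed_gt D u : directed D -> D u -> exists2 v, D v & u < v.
Proof.
move=> dD Du; have sm : small K unit.
  by move=> g; have [b bP] := K_nat (fun=> g tt); exists b => -[]; apply: (bP 0%N).
by have [v Dv /(_ tt)] := dD unit sm (fun=> u) (fun=> Du); exists v.
Qed.

Lemma directed_tail D y u : directed D -> D (Cons y u) ->
  (forall z v, D (Cons z v) -> z <= y) -> directed [set v | D (Cons y v)].
Proof.
move=> dD Du y_max I sm g Dg.
have [e De eP] := dD I sm (fun i => Cons y (g i)) Dg.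
(* The bound [e] may lie below [Cons y u]. A word [f] beyond both starts with [y], the largest first
   letter, unless it is [Top], which nothing in [D] could exceed. *)
have [f [Df uf ef]] : exists f, [/\ D f, Cons y u < f & e <= f].
  have [ue|eu] := ltP (Cons y u) e; first by exists e.
  by have [f Df uf] := directed_gt dD Du; exists f; rewrite (le_trans eu (ltW uf)).
have [h Dh] := directed_gt dD Df.
case: f Df uf ef => [|| z f] Df uf ef //; last first.
  have zy : z = y.
    by move: uf; rewrite lt_Cons ltNge (y_max _ _ Df) => /andP[/eqP].
  exists f => [|i]; first by rewrite /= -zy.
  by have := lt_le_trans (eP i) ef; rewrite lt_Cons zy ltxx eqxx.
by have [] := directed_gt dD Df; case.
Qed.

Fixpoint wsize w : nat := if w is Cons _ u then (wsize u).+1 else 0.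

(** If the first letters in [D] are unbounded, [t] is empty. Otherwise there is a largest one, and
    the tails after it form a directed set with a smaller size bound. *)
Lemma directed_cut_size D n : directed D ->
  (forall u, D u -> exists v, [/\ D v, u <= v & (wsize v <= n)%N]) ->
  exists t, (forall u, D u -> u < wcat t Top) /\
    forall x, exists2 u, D u & wcat t (Cons x Top) <= u.
Proof.
elim: n D => [|n IHn] D dD cofD; have [u Du] := directed_nonempty dD;
  have [v Dv uv] := directed_gt dD Du.
  have [w [Dw vw]] := cofD _ Dv; case: w Dw vw => // Dw vw _.
    by have := lt_le_trans uv vw; rewrite lt_Bot.
  by have [w' _] := directed_gt dD Dw; case: w'.
have D_Top w : D w -> w < Top.
  by move=> /(directed_gt dD)[w' _ /lt_le_trans]; apply; rewrite leNgt; case: (w').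
pose L := [set x | exists u, D (Cons x u)].
have [L_unb|] := pselect (forall b, exists2 x, L x & b < x).
  exists [::]; split=> [//|x].
  by have [y [w Dw] xy] := L_unb x; exists (Cons y w) => //; apply/ltW; rewrite lt_Cons xy.
move=> /existsNP[b /forall2NP bP].
have sm : small K {x | L x}.
  have [b' bb'] := K_nat (fun=> b); apply: (@K_reg _ b') => x Lx.
  have [//|/negP] := bP x; rewrite -leNgt => /le_lt_trans; apply; apply: (bb' 0%N).
(* One word per first letter makes a small family, and a word of [D] above it starts with the
   largest first letter. *)
have /choice[g gP] : forall i : {x | L x}, exists u, D (Cons (sval i) u).
  by case=> x [w Dw]; exists w.
have [e De eP] := dD _ sm (fun i => Cons (sval i) (g i)) gP.
have [f Df ef] := directed_gt dD De.
have ue : exists y w, f = Cons y w.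
  case: f Df ef => [_|/D_Top//|y w _ _]; last by exists y, w.
  by rewrite lt_Bot.
have [y [w fE]] := ue; subst f.
have y_max z z' : D (Cons z z') -> z <= y.
  move=> Dz; have /= := lt_trans (eP (exist L z (ex_intro _ z' Dz))) ef.
  by rewrite lt_Cons le_eqVlt => /orP[->|/andP[->]]; rewrite ?orbT.
have [z Dz|t [tD tcof]] := IHn _ (directed_tail dD Df y_max).
  have [v' [Dv' zv' sv']] := cofD _ Dz; case: v' Dv' zv' sv' => [||y' z'] Dv' zv' sv'.
  - by move: zv'; rewrite leNgt.
  - by move: (D_Top _ Dv').
  exists z'.
  have y'y : y' = y.
    apply/eqP; rewrite eq_le (y_max _ _ Dv') /= leNgt; apply: contraTN zv' => yy.
    by rewrite -ltNge lt_Cons yy.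
  subst y'; split=> //; move: zv'; rewrite !leNgt lt_Cons ltxx eqxx //.
exists (y :: t); split=> [z Dz|x].
  case: z Dz => [//|/D_Top//|z z' Dz]; rewrite lt_Cons.
  have := y_max _ _ Dz; rewrite le_eqVlt => /orP[/eqP zy|->//].
  by subst z; rewrite eqxx (tD _ Dz) orbT.
have [z Dz xz] := tcof x; exists (Cons y z) => //.
by move: xz; rewrite !leNgt lt_Cons ltxx eqxx.
Qed.

(** Were no size bound cofinal, each [n] would give an element of [D] above all those of size at
    most [n]; a common bound [e] of these countably many elements contradicts its own size. *)
Lemma directed_cut D : directed D ->
  exists t, (forall u, D u -> u < wcat t Top) /\
    forall x, exists2 u, D u & wcat t (Cons x Top) <= u.
Proof.
move=> dD; suff [n nP] : exists n, forall u, D u ->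
    exists v, [/\ D v, u <= v & (wsize v <= n)%N] by apply: directed_cut_size nP.
apply: contrapT => /forallNP nex.
have /choice[g gP] : forall n, exists u, D u /\ forall v, D v -> (wsize v <= n)%N -> v < u.
  move=> n; have /existsNP[u /not_implyP[Du uP]] := nex n; exists u; split=> // v Dv nv.
  by rewrite ltNge; apply/negP => uv; apply: uP; exists v.
have [e De eP] := dD nat K_nat g (fun n => (gP n).1).
by have := eP (wsize e); rewrite ltNge ltW // (gP _).2.
Qed.

End Cuts.

Lemma inj_card_leT (T U : Type) (f : T -> U) :
  injective f -> [set: T] #<= [set: U].
Proof.
move=> f_inj; have /card_eqPle[_ Tf] := inj_card_eq (A := [set: T]) (in2W f_inj).
exact: card_le_trans Tf (card_leT _).
Qed.

(** * The chain of admissible words *)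

Section Chain.
Variables (d : Order.disp_t) (K : orderType d) (S : seq K -> set K).

(** Removing [Top], the largest word, leaves no right endpoint. *)
Definition word_chain := {w : word K | `[< admissible S w /\ w <> Top >]}.

HB.instance Definition _ := SubChoice.on word_chain.
HB.instance Definition _ := [SubChoice_isSubOrder of word_chain by <: with d].

Implicit Types (a b c x y : K) (u v w : word K) (r s t : seq K) (z : word_chain).

Lemma val_admissible z : admissible S (val z).
Proof. by have /asboolP[] := valP z. Qed.

Lemma val_neq_Top z : val z <> Top.
Proof. by have /asboolP[] := valP z. Qed.

Lemma admissible_val w : admissible S w -> w <> Top -> exists z, val z = w.
Proof.
move=> aw wT; have Pw : `[< admissible S w /\ w <> Top >] by apply/asboolP.
by exists (exist _ w Pw).
Qed.

Lemma extension_subproof r x w : Bot_free w ->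
  `[< admissible S (wcat r (Cons x w)) /\ wcat r (Cons x w) <> Top >].
Proof.
move=> bw; apply/asboolP; split; last by case: r.
by apply: Bot_free_admissible; rewrite Bot_free_wcat.
Qed.

Definition extension r x w (bw : Bot_free w) : word_chain :=
  exist _ (wcat r (Cons x w)) (extension_subproof r x bw).

Definition top_point r x : word_chain := extension r x (w := Top) isT.

Hypothesis K_reg : forall (A : set K) b, (forall x, A x -> x < b) -> small K {x | A x}.
Hypothesis K_nat : small K nat.
Variable x0 : K.

Let K_gt : forall x, exists y, x < y := exists_gt K_nat.

Lemma word_chain_between u z : u < val z ->
  exists r x, forall w, u < wcat r (Cons x w) < val z.
Proof. exact: (admissible_between K_gt x0 (val_admissible z)). Qed.

Lemma word_chain_dense : densely_ordered word_chain.
Proof.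
move=> y z yz; have [r [x rx]] := word_chain_between (u := val y) yz.
by exists (top_point r x); apply: rx.
Qed.

Lemma word_chain_endless : without_endpoints word_chain.
Proof.
move=> z; split.
  have [|r [x rx]] := @word_chain_between Bot z.
    by rewrite Bot_lt; apply/eqP/admissible_neq_Bot/val_admissible.
  by exists (top_point r x); have /andP[_] := rx Top.
have := val_admissible z; have := @val_neq_Top z.
case zE : (val z) => [//|//|x u] _ _; have [y xy] := K_gt x.
by exists (top_point [::] y); rewrite -lt_val zE /= lt_Cons xy.
Qed.

(** The interval contains a whole block, which receives the chain through [spread]: its values end
    in [Top], so they are admissible after any prefix. *)
Lemma word_chain_embeds : embeds_in_open_intervals word_chain.
Proof.
move=> i i_open [z zi]; have [x1 lt01] := K_gt x0.
have [u uz uP] : exists2 u, u < val z &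
    forall y : word_chain, u < val y -> val y < val z -> y \in i.
  case: i i_open zi => [[[]a|[]] [[]b|[]]] // _; rewrite [z \in _]in_itv.
  - move=> /andP[az zb]; exists (val a) => // y ay; rewrite lt_val => yz.
    by rewrite in_itv /= (lt_trans yz zb) -lt_val ay.
  - move=> /andP[az _]; exists (val a) => // y ay yz.
    by rewrite in_itv /= andbT -lt_val.
  - move=> /andP[_ zb]; exists Bot => [|y _]; last by rewrite lt_val in_itv /= => /lt_trans; apply.
    by rewrite Bot_lt; apply/eqP/admissible_neq_Bot/val_admissible.
  - move=> _; exists Bot => [|y _ yz]; last by rewrite in_itv.
    by rewrite Bot_lt; apply/eqP/admissible_neq_Bot/val_admissible.
have [r [x rx]] := word_chain_between uz.
exists (fun y : word_chain => extension r x (Bot_free_spread x0 x1 (val y))).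
split=> [y y' yy'|y].
  by rewrite -lt_val /= lt_wcat lt_Cons ltxx eqxx spread_lt.
by have /andP[uy yz] := rx (spread x0 x1 (val y)); apply: uP.
Qed.

(** Letters are doubled so that the parity of the length tells the two endings apart. *)
Fixpoint word_seq w : seq K :=
  match w with
  | Bot => [:: x0]
  | Top => [::]
  | Cons x u => [:: x, x & word_seq u]
  end.

Lemma word_seq_inj : injective word_seq.
Proof. by elim=> [|| x u IHu] [|| y v] //= [-> _ /IHu->]. Qed.

Lemma word_chain_card : (exists code : seq K -> K, injective code) ->
  [set: word_chain] #= [set: K].
Proof.
move=> [code code_inj]; apply/card_eqPle; split.
  apply: (@inj_card_leT _ _ (fun z => code (word_seq (val z)))).
  by move=> z z' /code_inj/word_seq_inj/val_inj.
by apply: (@inj_card_leT _ _ (top_point [::])) => x y [].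
Qed.

Hypothesis S_stationary : forall s, stationary (S s).
Hypothesis S_disjoint : forall s t a, S s a -> S t a -> s = t.

(** * Rigidity *)

Section Epimorphism.
Variable f : word_chain -> word_chain.
Hypothesis f_epi : epimorphism f.

Let f_le : {homo f : z z' / z <= z'}. Proof. exact: f_epi.2. Qed.

Let f_lt z z' : f z < f z' -> z < z'.
Proof. by apply: contraTT; rewrite -!leNgt; apply: f_le. Qed.

(** Preimages of the points [top_point s b] bound all small families in the preimage of the cut, so
    that preimage is directed and [directed_cut] applies. *)
Lemma epimorphism_preimage_cut s : exists t, forall z,
  (val (f z) < wcat s Top) = (val z < wcat t Top).
Proof.
have /choice[q qP] := fun x => f_epi.1 (top_point s x).
have low z : val (f z) < wcat s Top -> exists x, f z < top_point s x.
  by move=> /(lt_wcat_Top K_gt x0)[x xP]; exists x; rewrite -lt_val; apply: xP.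
pose D := [set u | exists2 z, val z = u & val (f z) < wcat s Top].
have [|t [tD tcof]] := @directed_cut _ _ K_reg K_nat x0 D.
  move=> I smI g Dg.
  have /choice[h hP] : forall i, exists x, forall z, val z = g i -> f z < top_point s x.
    move=> i; have [z zg /low[x zx]] := Dg i; exists x => z' z'g.
    by have -> : z' = z by apply: val_inj; rewrite zg.
  have [b hb] := smI h; exists (val (q b)).
    by exists (q b) => //; rewrite qP /= lt_wcat.
  move=> i; have [z zg _] := Dg i; rewrite -zg lt_val; apply: f_lt.
  rewrite qP; apply: lt_trans (hP i z zg) _.
  by rewrite -lt_val /= lt_wcat lt_Cons hb.
exists t => z; apply/idP/idP => [zs|]; first by apply: tD; exists z.
move=> /(lt_wcat_Top K_gt x0)[x xP].
have [_ [z' <- z's] xz'] := tcof x.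
apply: le_lt_trans z's; rewrite Order.le_val; apply/f_le; rewrite -Order.le_val.
exact/ltW/(lt_le_trans (xP Top)).
Qed.

(* Along a club of [c], the cut of [wcat t Top] just below the [c]-th block is mapped
   to the corresponding cut of [wcat s Top], and a filled cut is mapped to a filled
   cut, so [S s] meets that club inside [S t]. *)
Lemma epimorphism_cut_eq s t :
  (forall z, (val (f z) < wcat s Top) = (val z < wcat t Top)) -> s = t.
Proof.
move=> st.
have /choice[g gP] : forall x, exists y,
    f (top_point t x) < top_point s y /\ top_point s x <= f (top_point t y).
  move=> x; have [y1 y1P] : exists y, f (top_point t x) < top_point s y.
    have /(lt_wcat_Top K_gt x0)[y yP] : val (f (top_point t x)) < wcat s Top.
      by rewrite st /= lt_wcat.
    by exists y; rewrite -lt_val; apply: yP.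
  have [y2 y2P] : exists y, top_point s x <= f (top_point t y).
    have [z zx] := f_epi.1 (top_point s x).
    have /(lt_wcat_Top K_gt x0)[y yP] : val z < wcat t Top.
      by rewrite -st zx /= lt_wcat.
    by exists y; rewrite -zx; apply/f_le/ltW; rewrite -lt_val; apply: yP.
  have mono r : {homo top_point r : a b / a <= b}.
    move=> a b; rewrite !le_eqVlt => /orP[/eqP->|ab]; first by rewrite eqxx.
    by rewrite -lt_val /= lt_wcat lt_Cons ab orbT.
  exists (Order.max y1 y2); split.
    by apply: lt_le_trans y1P (mono _ _ _ _); rewrite le_max lexx.
  by apply: le_trans y2P (f_le (mono _ _ _ _)); rewrite le_max lexx orbT.
have [c [Ssc lc gc]] := S_stationary s g.
apply: contrapT => nst.
have [z zE] : exists z, val z = wcat t (Cons c Bot).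
  apply: admissible_val; last by case: (t).
  by apply/admissible_limit; split=> // Stc; apply/nst/(S_disjoint Ssc).
(* As [c] lies in [S s], the word on the left is a gap of the chain, so [f z] cannot equal it. *)
have sc_f : wcat s (Cons c Bot) < val (f z).
  rewrite lt_neqAle leNgt; apply/andP; split.
    apply/eqP => scE; have := val_admissible (f z).
    by rewrite -scE => /admissible_limit[_]; apply.
  apply/negP => /(lt_wcat_limit lc)[a ac /(_ Top)].
  have [_ sa] := gP a; rewrite -[wcat _ _]/(val (top_point s a)) lt_val ltNge.
  rewrite (le_trans sa) //; apply/f_le/ltW.
  by rewrite -lt_val zE /= lt_wcat lt_Cons gc.
have [r [x /(_ Top)/andP[scy yz]]] := word_chain_between sc_f.
(* A preimage of a point between the gap and [f z] lies below [z], hence below some [top_point t a]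
   with [a < c]; its image would then be below the gap. *)
have [z' z'y] := f_epi.1 (top_point r x).
have : z' < z by apply: f_lt; rewrite z'y -lt_val.
rewrite -lt_val zE => /(lt_wcat_limit lc)[a ac /(_ Top) z'a].
have : f z' < top_point s (g a).
  by apply: le_lt_trans (gP a).1; apply/f_le/ltW; rewrite -lt_val.
rewrite z'y -lt_val /= => /(lt_trans scy).
by rewrite lt_wcat lt_Cons (lt_gtF (gc a ac)) (gt_eqF (gc a ac)).
Qed.

Lemma epimorphism_id : f =1 id.
Proof.
have cut s z : (val (f z) < wcat s Top) = (val z < wcat s Top).
  have [t st] := epimorphism_preimage_cut s.
  by rewrite st (epimorphism_cut_eq st).
move=> z; case: (ltgtP (f z) z) => //; rewrite -lt_val.
  (* The separating word ends in [Top], so it is itself one of the cuts fixed by [f]. *)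
  move=> /word_chain_between[r [x /(_ Top)]]; rewrite -wcat_rcons cut => /andP[zx].
  by rewrite (lt_gtF zx).
move=> /word_chain_between[r [x /(_ Top)]]; rewrite -wcat_rcons -cut => /andP[zx].
by rewrite (lt_gtF zx).
Qed.

End Epimorphism.
End Chain.

(** * From the regular cardinal to the chain *)

Lemma well_order_isOrder (K : Type) (R : rel K) : wochoice.well_order R ->
  [/\ antisymmetric R, transitive R & total R].
Proof.
(* A well-order is given here by unique least elements; sets of at most three elements yield the
   order axioms. *)
move=> R_wo; have min3 x y z : exists m,
    [/\ m = x \/ m = y \/ m = z, R m x, R m y & R m z].
  pose A : {pred K} := fun m => `[< m = x \/ m = y \/ m = z >].
  have [|m [[/asboolP mA m_le] _]] := R_wo A; first by exists x; apply/asboolP; left.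
  by exists m; split=> //; apply: m_le; apply/asboolP; [left|right; left|right; right].
have Rxx x : R x x by have [m [[->|[->|->]]]] := min3 x x x.
have anti : antisymmetric R.
  move=> x y /andP[xy yx].
  pose A : {pred K} := fun m => `[< m = x \/ m = y >].
  have [|m [_ m_uniq]] := R_wo A; first by exists x; apply/asboolP; left.
  have <- : m = x.
    by apply: m_uniq; split=> [|z /asboolP[]->//]; apply/asboolP; left.
  by apply: m_uniq; split=> [|z /asboolP[]->//]; apply/asboolP; right.
split=> // [y x z xy yz|x y]; last first.
  by have [m [[->|[->|->]] ? ? ?]] := min3 x y y; apply/orP; tauto.
have [m [[->|[->|->]] mx my mz]] := min3 x y z => //.
  by have <- : y = x by apply: anti; rewrite mx xy.
by have -> : z = y by apply: anti; rewrite my yz.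
Qed.

Theorem theorem5p2 (K : Type) :
  regular_cardinal K -> ~ countable [set: K] ->
  exists (d : Order.disp_t) (X : orderType d),
    [/\ densely_ordered X,
        without_endpoints X,
        [set: X] #= [set: K],
        epimorphism_rigid X
      & embeds_in_open_intervals X].
Proof.
move=> [K_inf [R [R_wo R_init] R_reg]] K_unc.
have [R_anti R_trans R_total] := well_order_isOrder R_wo.
pose d := Order.Disp tt tt.
pose O : orderType d := HB.pack {classic K} (Order.isOrder.Build d {classic K}
  (fun _ _ => erefl) (fun _ _ => erefl) (fun _ _ => erefl) R_anti R_trans R_total).
have [x0 _] : [set: O] !=set0 := infinite_setN0 K_inf.
have O_wf (A : set O) : A !=set0 -> exists2 x, A x & forall y, A y -> x <= y.
  move=> [a Aa]; have [|x [[/asboolP Ax x_le] _]] := R_wo (fun x => `[< A x >]).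
    by exists a; apply/asboolP.
  by exists x => // y Ay; apply: x_le; apply/asboolP.
have O_card (A : set O) : (forall b, exists2 x, A x & b <= x) -> A #= [set: O].
  exact: R_reg.
(* An unbounded family has a cofinal range, which by regularity has the size of [K]. *)
have O_small (I : Type) : ~~ ([set: O] #<= [set: I]) -> small O I.
  move=> KI g; apply: contrapT => /forallNP g_unb; apply: (negP KI).
  have /card_eqPle[_ /card_le_trans] : range g #= [set: O].
    apply: O_card => b; have /existsNP[i /negP gi] := g_unb b.
    by exists (g i); [exists i|rewrite leNgt].
  by apply; apply: card_image_le.
have O_nat : small O nat by apply: O_small; apply/negP.
(* A bounded set lies in a proper initial segment, which is smaller than [K] because [R] is an
   initial ordinal. *)
have O_reg (A : set O) b : (forall x, A x -> x < b) -> small O {x | A x}.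
  move=> A_lt; apply: O_small; apply/negP => KA; apply: (negP (R_init b)); apply/card_eqPle.
  split; last exact: card_leT.
  apply: card_le_trans KA _.
  have sval_inj : injective (@sval O A) by move=> [x Ax] [y Ay]; apply: eq_exist.
  have /card_eqPle[_ /card_le_trans] := inj_card_eq (A := setT) (in2W sval_inj).
  apply; apply: subset_card_le => _ [[x Ax] _ <-] /=.
  by have := A_lt _ Ax; rewrite lt_neqAle => /andP[/eqP].
have [S [S_st S_disj]] := disjoint_stationary_seq O_wf O_reg O_nat O_card x0.
exists d, (word_chain S); split.
- exact: word_chain_dense O_nat x0.
- exact: word_chain_endless O_nat x0.
- exact: word_chain_card (seq_code O_wf O_reg O_nat O_card x0).
- by move=> f; apply: epimorphism_id.
- exact: word_chain_embeds O_nat x0.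
Qed.
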